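(* Let $N,s$ be positive integers, let $\mathbf{M}_1,\dots,\mathbf{M}_N\in\mathbb{R}^{s\times s}$, and let $k$ be an integer with $2\le k\le N+1$. Let $\mathbf{L}$ and $\mathbf{L}_M=\mathbf{L}_M(k)$ be the $(N+1)s\times(N+1)s$ matrices defined in the context. Then $\mathbf{L}_M^{-\top}\mathbf{L}^\top\mathbf{L}\mathbf{L}_M^{-1}$ has at least $rs$ unit eigenvalues (eigenvalues equal to $1$, counted with multiplicity), where $r=N+1-2\left\lfloor\frac{N}{k}\right\rfloor$.
   Context: $\mathbf{L}\in\mathbb{R}^{(N+1)s\times(N+1)s}$ is the block matrix with $s\times s$ blocks whose diagonal blocks are the identity $\mathbf{I}$, whose $(j+1,j)$th block is $-\mathbf{M}_j$ for $j=1,\dots,N$, and whose other blocks are zero. For $k\in\mathbb{N}$, $\mathbf{L}_M=\mathbf{L}_M(k)\in\mathbb{R}^{(N+1)s\times(N+1)s}$ is the block matrix with $s\times s$ blocks such that, for $i,j=1,\dots,N+1$, its $(i,j)$th block is $\mathbf{I}$ if $i=j$; $-\mathbf{M}_j$ if $i=j+1$ and $j$ is not divisible by $k$; and $\mathbf{0}$ otherwise. $\mathbf{X}^{-\top}$ denotes $(\mathbf{X}^{-1})^\top$. *)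

(* Defs.v *)
From mathcomp Require Import all_boot all_order all_algebra.
From mathcomp Require Import reals.

Set Implicit Arguments.
Unset Strict Implicit.
Unset Printing Implicit Defensive.

Import GRing.Theory.
Local Open Scope ring_scope.

(* Indices are 0-based: [M j] is the matrix M_{j+1}, for j = 0, ..., N - 1, and
   block rows and columns run over 0, ..., N.  [insub j : option 'I_N] reads a
   column index j : 'I_N.+1 as an index of M.  It fails only for the last
   column j = N, which has no block below the diagonal, so the default value 0
   is never used where i = j + 1. *)
Definition subdiag (R : realType) (N s : nat) (M : 'I_N -> 'M[R]_s)
    (j : 'I_N.+1) : 'M[R]_s :=
  if insub (j : nat) is Some j' then - M j' else 0.

Definition Lmx (R : realType) (N s : nat) (M : 'I_N -> 'M[R]_s) :
    'M[R]_(\sum_(i < N.+1) s) :=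
  \mxblock_(i < N.+1, j < N.+1)
    (if i == j then 1%:M
     else if i == j.+1 :> nat then subdiag M j
     else 0 : 'M[R]_s).

(* In 0-based indexing the condition "j is not divisible by k" concerns j + 1.
   The matrix is lower triangular with unit diagonal, hence invertible, so
   [invmx (LMmx M k)] is its inverse. *)
Definition LMmx (R : realType) (N s : nat) (M : 'I_N -> 'M[R]_s) (k : nat) :
    'M[R]_(\sum_(i < N.+1) s) :=
  \mxblock_(i < N.+1, j < N.+1)
    (if i == j then 1%:M
     else if (i == j.+1 :> nat) && ~~ (k %| j.+1)%N then subdiag M j
     else 0 : 'M[R]_s).

(* Main.v *)
Require Import Defs.
From mathcomp Require Import all_boot all_order all_algebra.
From mathcomp Require Import reals.

Set Implicit Arguments.
Unset Strict Implicit.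
Unset Printing Implicit Defensive.

Import GRing.Theory.
Local Open Scope ring_scope.

(** Write L for [Lmx M], L_M for [LMmx M k], and put F = (L - L_M) L_M^-1, which
    makes sense because L_M is lower triangular with unit diagonal.  Then
    L L_M^-1 = I + F, so the matrix of the theorem is (I + F)^T (I + F), and it
    differs from the identity by F^T (I + F) + F, of rank at most 2 rank F.

    The nonzero columns of L - L_M lie in the N %/ k block columns whose
    (1-based) index is a multiple of k that is at most N; hence
    rank F <= (N %/ k) s ([rank_LmxB]).  The eigenvalue 1 therefore has geometric
    multiplicity at least (N + 1) s - 2 (N %/ k) s, and its algebraic multiplicity
    is at least as large ([leq_geometric_algebraic_mult]). *)

(** The geometric multiplicity of [a] is at most its algebraic multiplicity.
    Factoring A - a = C E P with C, P invertible and E a partial identity of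
    rank r, the matrix A - a is similar to P C E, whose columns of index at least
    r vanish; so 'X - a can be factored out of n - r columns of the characteristic
    matrix. *)
Lemma leq_geometric_algebraic_mult (F : fieldType) (n : nat) (A : 'M[F]_n)
    (a : F) :
  (n - \rank (A - a%:M)%R <= mup a (char_poly A))%N.
Proof.
set S := A - a%:M; set r := \rank S; set P := row_ebase S.
pose T := P *m col_ebase S *m (pid_mx r : 'M[F]_n).
pose Y : {poly F} := 'X - a%:P.
have PU : map_mx polyC P \in unitmx by rewrite map_unitmx row_ebase_unit.
have conj : map_mx polyC P *m char_poly_mx A
    = (Y%:M - map_mx polyC T) *m map_mx polyC P.
  have -> : char_poly_mx A = Y%:M - map_mx polyC S.
    by rewrite /char_poly_mx /S map_mxB map_scalar_mx /Y raddfB opprB addrA subrK.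
  rewrite mulmxBr mulmxBl scalar_mxC -!map_mxM.
  by rewrite -{1}(mulmx_ebase S) !mulmxA.
(* Since the columns of T of index at least r are zero, those of Y - T are Y
   times the columns of the identity; [G] is Y - T with that factor removed, and
   [d] collects the factors. *)
pose G : 'M[{poly F}]_n := \matrix_(i, j)
  if (j < r)%N then (Y%:M - map_mx polyC T) i j else (i == j)%:R.
pose d : 'rV[{poly F}]_n := \row_j if (j < r)%N then 1 else Y.
have T0 (i j : 'I_n) : (r <= j)%N -> T i j = 0.
  move=> rj; rewrite mxE big1 // => l _; rewrite !mxE.
  case: eqP => [->|_] /=; last by rewrite mulr0.
  by rewrite ltnNge rj mulr0.
clearbody T.
have fac : Y%:M - map_mx polyC T = G *m diag_mx d.
  apply/matrixP=> i j; rewrite mul_mx_diag !mxE.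
  case: ltnP => rj; first by rewrite mulr1.
  by rewrite T0 // polyC0 subr0 mulr_natl.
rewrite mup_geq ?monic_neq0 ?char_poly_monic //.
have detE : char_poly A = \det G * \prod_j d 0 j.
  rewrite -det_diag -det_mulmx -fac.
  move: (congr1 determinant conj); rewrite !det_mulmx mulrC.
  by apply: mulIr; rewrite -unitmxE.
rewrite detE; apply: dvdp_mull.
suff -> : \prod_j d 0 j = Y ^+ (n - r) by [].
rewrite -[in RHS](card_ord n).
under eq_bigr => j _ do rewrite mxE.
rewrite (bigID (fun j : 'I_n => (j < r)%N)) /= big1 => [|j ->//].
rewrite mul1r; under eq_bigr => j /negbTE -> do [].
rewrite prodr_const; congr (_ ^+ _).
have := cardC (fun j : 'I_n => (j < r)%N).
have -> : #|[pred j : 'I_n | (j < r)%N]| = r.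
  by rewrite -sum1_card (big_ord_narrow (rank_leq_col S)) /= sum1_card card_ord.
by move=> <-; rewrite addKn.
Qed.

Lemma LMmx_unit (R : realType) (N s : nat) (M : 'I_N -> 'M[R]_s) (k : nat) :
  LMmx M k \in unitmx.
Proof.
have trig : is_trig_mx (LMmx M k).
  apply/is_trig_mxblockP; split=> [i j ij|i]; last first.
    by rewrite eqxx; apply: scalar_mx_is_trig.
  by rewrite -val_eqE !ltn_eqF // ltnW.
rewrite unitmxE (det_trig trig) big1 ?unitr1 // => i _.
by rewrite !mxE eqxx !mxE eqxx.
Qed.

(** Right multiplication by a block diagonal 0-1 matrix that keeps only the
    block columns where the two matrices may differ leaves L - L_M unchanged; the
    rank of that diagonal matrix gives the bound. *)
Lemma rank_LmxB (R : realType) (N s : nat) (M : 'I_N -> 'M[R]_s) (k : nat) :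
  (\rank (Lmx M - LMmx M k)%R <= N %/ k * s)%N.
Proof.
(* The last column j = N has no block below the diagonal, even if k divides
   N + 1. *)
pose b (j : 'I_N.+1) := (j < N)%N && (k %| j.+1)%N.
have -> : Lmx M - LMmx M k
    = (Lmx M - LMmx M k) *m \mxdiag_j (if b j then 1%:M else 0 : 'M[R]_s).
  rewrite -mxblockB mul_mxblock_mxdiag; apply: eq_mxblock => i j.
  case: (boolP (b j)) => [_|]; first by rewrite mulmx1.
  rewrite mulmx0 /b; case: (i == j); first by rewrite subrr.
  case: eqP => //= [ij|_]; last by rewrite subr0.
  have -> /= : (j < N)%N by rewrite -ltnS -ij.
  by move=> /negbTE ->; rewrite subrr.
apply: leq_trans (mxrankM_maxr _ _) _; rewrite rank_mxdiag.
have rkb j : \rank (if b j then 1%:M else 0 : 'M[R]_s) = (b j * s)%N.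
  by case: (b j); rewrite ?mxrank1 ?mxrank0 ?mul1n.
under eq_bigr => j _ do rewrite rkb.
rewrite -big_distrl /= leq_mul2r big_ord_recr /= {2}/b ltnn addn0.
rewrite divn_count_dvd big_add1 /= big_mkord.
by rewrite (eq_bigr (fun i : 'I_N => (k %| i.+1 : nat)%N)) ?leqnn ?orbT // => i _;
  rewrite /b /= ltn_ord.
Qed.

Theorem proposition1 (R : realType) (N s : nat) (M : 'I_N -> 'M[R]_s) (k : nat)
    (N_gt0 : (0 < N)%N) (s_gt0 : (0 < s)%N) (hk : (2 <= k <= N.+1)%N) :
  ((N.+1 - 2 * (N %/ k)) * s
     <= mup 1 (char_poly ((invmx (LMmx M k))^T *m (Lmx M)^T *m Lmx M
                            *m invmx (LMmx M k))))%N.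
Proof.
set U := invmx _; set A := _ *m U.
pose F := (Lmx M - LMmx M k) *m U.
have LU : Lmx M *m U = 1%:M + F.
  by rewrite /F mulmxBl mulmxV ?LMmx_unit // addrC subrK.
have trF : (1%:M + F)^T = 1%:M + F^T by rewrite [LHS]linearD /= tr_scalar_mx.
have AE : A - 1%:M = F^T *m (1%:M + F) + F.
  by rewrite /A -mulmxA LU -trmx_mul LU trF mulmxDl mul1mx
             addrAC [1%:M + F]addrC addrK addrC.
have rF : (\rank F <= N %/ k * s)%N.
  exact: leq_trans (mxrankM_maxl _ _) (rank_LmxB _ _).
have rA : (\rank (A - 1%:M)%R <= 2 * (N %/ k) * s)%N.
  rewrite AE; apply: leq_trans (mxrank_add _ _) _.
  rewrite mul2n -addnn mulnDl leq_add //.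
  by apply: leq_trans (mxrankM_maxl _ _) _; rewrite mxrank_tr.
apply: leq_trans (leq_geometric_algebraic_mult A 1).
by rewrite mulnBl; apply: leq_sub; rewrite // sum_nat_const card_ord.
Qed.
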